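(* Let $E \subseteq \mathbb{R}^n$ and $F \subseteq \mathbb{R}^m$ be non-empty and bounded and let $\theta \in [0,1]$. Then $$\underline{\dim}_{\theta} E + \underline{\dim}_{\theta} F\ \leq\ \underline{\dim}_{\theta} (E \times F)\ \leq\ \overline{\dim}_\theta ( E \times F)\ \leq\ \overline{\dim}_\theta E + \overline{\dim}_{\mathrm{B}} F.$$
   Context: For a set $U$ in Euclidean space, $|U|$ denotes its diameter. A cover $\{U_i\}$ of $F$ is a finite or countable collection of sets with $F\subseteq\bigcup_i U_i$. For a bounded subset $F$ of a Euclidean space and $0\leq\theta\leq 1$, the lower $\theta$-intermediate dimension $\underline{\dim}_{\theta} F$ is the infimum of all $s\geq 0$ such that for all $\epsilon>0$ and all $\delta_0>0$ there exist $0<\delta\leq\delta_0$ and a cover $\{U_i\}$ of $F$ with $\delta^{1/\theta}\leq |U_i|\leq\delta$ for all $i$ and $\sum_i |U_i|^s\leq\epsilon$. The upper $\theta$-intermediate dimension $\overline{\dim}_{\theta} F$ is the infimum of all $s\geq 0$ such that for all $\epsilon>0$ there exists $\delta_0>0$ such that for all $0<\delta\leq\delta_0$ there is a cover $\{U_i\}$ of $F$ with $\delta^{1/\theta}\leq |U_i|\leq\delta$ for all $i$ and $\sum_i |U_i|^s\leq\epsilon$. When $\theta=0$, $\delta^{1/\theta}$ is read as $0$ (no lower restriction on diameters), so that $\underline{\dim}_0F=\overline{\dim}_0F$ is the Hausdorff dimension of $F$; when $\theta=1$ these are the lower and upper box dimensions. $\overline{\dim}_{\mathrm{B}}$ is the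 upper box dimension. $E\times F\subseteq\mathbb{R}^{n+m}$ carries the Euclidean metric. *)

(* Defs.v *)
From HB Require Import structures.
From mathcomp Require Import all_boot all_order all_algebra.
From mathcomp Require Import all_classical all_reals all_analysis.

Set Implicit Arguments.
Unset Strict Implicit.
Unset Printing Implicit Defensive.

Import Order.TTheory GRing.Theory Num.Theory.
Import numFieldNormedType.Exports.

Local Open Scope classical_set_scope.
Local Open Scope ring_scope.
Local Open Scope ereal_scope.

(* The library norm on 'rV[R]_n is the max norm, hence this explicit
   Euclidean distance. *)
Definition eucl_dist (R : realType) (n : nat) (x y : 'rV[R]_n) : R :=
  Num.sqrt (\sum_(i < n) (x ord0 i - y ord0 i) ^+ 2)%R.

(* The point 0 only serves to make the diameter of set0 equal to 0; an
   unbounded set has diameter +oo. *)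
Definition diam (R : realType) (n : nat) (U : set 'rV[R]_n) : \bar R :=
  ereal_sup (0 |` [set (eucl_dist x y)%:E | x in U & y in U]).

(* delta ^ (1 / theta), read as 0 when theta = 0 (where the library would
   give theta^-1 = 0). *)
Definition lower_scale (R : realType) (theta delta : R) : R :=
  if theta == 0%R then 0%R else (delta `^ theta^-1)%R.

(* The covers are the families (U i)_(i in I) with I a set of naturals, so
   that they may be finite or countably infinite. *)
Definition has_cover (R : realType) (n : nat) (theta : R)
    (F : set 'rV[R]_n) (s delta eps : R) : Prop :=
  exists (I : set nat) (U : nat -> set 'rV[R]_n),
    [/\ F `<=` \bigcup_(i in I) U i,
        forall i, I i ->
          (lower_scale theta delta)%:E <= diam (U i) <= delta%:E
      & \esum_(i in I) (diam (U i) `^ s) <= eps%:E].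

Definition lower_dim (R : realType) (n : nat) (theta : R)
    (F : set 'rV[R]_n) : \bar R :=
  ereal_inf [set s%:E | s in [set s : R | (0 <= s)%R /\
    forall eps delta0 : R, (0 < eps)%R -> (0 < delta0)%R ->
      exists2 delta : R, (0 < delta <= delta0)%R &
        has_cover theta F s delta eps]].

Definition upper_dim (R : realType) (n : nat) (theta : R)
    (F : set 'rV[R]_n) : \bar R :=
  ereal_inf [set s%:E | s in [set s : R | (0 <= s)%R /\
    forall eps : R, (0 < eps)%R ->
      exists2 delta0 : R, (0 < delta0)%R &
        forall delta : R, (0 < delta <= delta0)%R ->
          has_cover theta F s delta eps]].

(* The least number of sets of diameter at most delta that cover F (+oo if
   no finite number suffices). *)
Definition covering_number (R : realType) (n : nat) (F : set 'rV[R]_n)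
    (delta : R) : \bar R :=
  ereal_inf [set (k%:R : R)%:E | k in [set k : nat |
    exists U : 'I_k -> set 'rV[R]_n,
      F `<=` \bigcup_i U i /\ forall i, diam (U i) <= delta%:E]].

(* limsup of log N_delta(F) / - log delta as delta -> 0+ *)
Definition upper_box_dim (R : realType) (n : nat) (F : set 'rV[R]_n) : \bar R :=
  limf_esup (fun delta : R =>
    lne (covering_number F delta) * ((- ln delta)^-1)%:E) (0%R : R)^'+.

Definition row_prod (R : realType) (n m : nat) (E : set 'rV[R]_n)
    (F : set 'rV[R]_m) : set 'rV[R]_(n + m) :=
  [set row_mx x y | x in E & y in F].

(* Main.v *)
Require Import Defs.
From HB Require Import structures.
From mathcomp Require Import all_boot all_order all_algebra.
From mathcomp Require Import all_classical all_reals all_analysis.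
From mathcomp Require Import measurable_realfun ring lra zify.

(* Lower bound. Fix a cover (W_i) of E x F. If t is not admissible for F, the
   slice over each x in E has sum |W_i|^t > eps, so the weights |W_i|^t / eps on
   the projections of the W_i to E form a fractional cover. Replacing each
   projection by boundedly many dyadic cells of comparable size makes the family
   nested, and a nested fractional cover contains an honest cover of no larger
   cost. Hence s is admissible for E as soon as s + t is for E x F.
   Upper bound. Each U_i x F, with |U_i| = d, is covered by O(1) * N_{d/2}(F)
   products of diameter at most d: a cell of U_i times a set covering part of F.
   In both directions the diameters are finally raised to prescribed values, so
   that they stay in the allowed range. *)

Import Order.TTheory GRing.Theory Num.Theory.
Import numFieldNormedType.Exports.

Set Implicit Arguments.
Unset Strict Implicit.

Local Open Scope classical_set_scope.
Local Open Scope ring_scope.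

(** * Euclidean distance and diameter *)

Lemma eucl_dist_ge0 (R : realType) n (x y : 'rV[R]_n) : 0 <= eucl_dist x y.
Proof. exact: sqrtr_ge0. Qed.

Lemma eucl_distC (R : realType) n (x y : 'rV[R]_n) :
  eucl_dist x y = eucl_dist y x.
Proof. by congr Num.sqrt; apply: eq_bigr => i _; rewrite -sqrrN opprB. Qed.

Lemma sqr_eucl_dist (R : realType) n (x y : 'rV[R]_n) :
  eucl_dist x y ^+ 2 = \sum_(i < n) (x ord0 i - y ord0 i) ^+ 2.
Proof. by rewrite sqr_sqrtr// sumr_ge0// => i _; exact: sqr_ge0. Qed.

Lemma eucl_dist_le (R : realType) n (x y : 'rV[R]_n) (d : R) : 0 <= d ->
  (eucl_dist x y <= d) = (\sum_(i < n) (x ord0 i - y ord0 i) ^+ 2 <= d ^+ 2).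
Proof.
by move=> d0; rewrite -sqr_eucl_dist ler_pXn2r// nnegrE eucl_dist_ge0.
Qed.

Lemma coord_le_eucl_dist (R : realType) n (x y : 'rV[R]_n) i :
  `|x ord0 i - y ord0 i| <= eucl_dist x y.
Proof.
rewrite -(@ler_pXn2r _ 2) ?nnegrE ?eucl_dist_ge0// real_normK ?num_real//.
rewrite sqr_eucl_dist (bigD1 i)//= lerDl sumr_ge0// => j _; exact: sqr_ge0.
Qed.

Lemma eucl_dist_le_sup (R : realType) n (x y : 'rV[R]_n) (h : R) : 0 <= h ->
  (forall i, `|x ord0 i - y ord0 i| <= h) -> eucl_dist x y <= n%:R * h.
Proof.
move=> h0 xyh; rewrite eucl_dist_le ?mulr_ge0//.
have : \sum_(i < n) (x ord0 i - y ord0 i) ^+ 2 <= \sum_(i < n) h ^+ 2.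
  apply: ler_sum => i _.
  by rewrite -real_normK ?num_real// ler_pXn2r// nnegrE.
rewrite sumr_const card_ord -[_ *+ n]mulr_natl => /le_trans; apply.
rewrite exprMn ler_wpM2r ?sqr_ge0//.
by rewrite -natrX ler_nat -mulnn; case: (n) => // k; rewrite leq_pmulr.
Qed.

Lemma eucl_dist_row_mx (R : realType) n m (x x' : 'rV[R]_n) (y y' : 'rV[R]_m) :
  eucl_dist (row_mx x y) (row_mx x' y') ^+ 2 =
  eucl_dist x x' ^+ 2 + eucl_dist y y' ^+ 2.
Proof.
rewrite !sqr_eucl_dist big_split_ord/=; congr (_ + _); apply: eq_bigr => i _.
  by rewrite !row_mxEl.
by rewrite !row_mxEr.
Qed.

Lemma eucl_dist_row_mxl (R : realType) n m (x x' : 'rV[R]_n) (y y' : 'rV[R]_m) :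
  eucl_dist x x' <= eucl_dist (row_mx x y) (row_mx x' y').
Proof.
rewrite -(@ler_pXn2r _ 2) ?nnegrE ?eucl_dist_ge0// eucl_dist_row_mx.
by rewrite lerDl sqr_ge0.
Qed.

Lemma eucl_dist_row_mxr (R : realType) n m (x x' : 'rV[R]_n) (y y' : 'rV[R]_m) :
  eucl_dist y y' <= eucl_dist (row_mx x y) (row_mx x' y').
Proof.
rewrite -(@ler_pXn2r _ 2) ?nnegrE ?eucl_dist_ge0// eucl_dist_row_mx.
by rewrite lerDr sqr_ge0.
Qed.

Lemma eucl_distxx (R : realType) n (x : 'rV[R]_n) : eucl_dist x x = 0.
Proof.
apply/eqP; rewrite eq_le eucl_dist_ge0 eucl_dist_le// expr0n/= big1 ?lexx//.
by move=> i _; rewrite subrr expr0n.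
Qed.

(** The only case of the triangle inequality that is used. After squaring, the cross term is
    controlled because a coordinate difference is at most the distance. *)
Lemma eucl_dist_shift (R : realType) n (i : 'I_n) (x y : 'rV[R]_n) (r : R) :
  eucl_dist x (y + r *: delta_mx ord0 i) <= eucl_dist x y + `|r|.
Proof.
rewrite eucl_dist_le ?addr_ge0// ?eucl_dist_ge0// (bigD1 i)//=.
rewrite !mxE !eqxx mulr1 opprD addrA.
rewrite (eq_bigr (fun j => (x ord0 j - y ord0 j) ^+ 2)); last first.
  by move=> j ji; rewrite !mxE (negbTE ji) andbF mulr0 addr0.
set S := \sum_(j < n | _) _.
have : eucl_dist x y ^+ 2 = (x ord0 i - y ord0 i) ^+ 2 + S.
  by rewrite sqr_eucl_dist (bigD1 i).
have := coord_le_eucl_dist x y i.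
move: (x ord0 i - y ord0 i) (eucl_dist x y) => a D aD DS.
have -> : S = D ^+ 2 - a ^+ 2 by rewrite DS; lra.
have : - a * r <= D * `|r|.
  by rewrite (le_trans (ler_norm _))// normrM normrN ler_wpM2r.
have rr : `|r| ^+ 2 = r ^+ 2 by rewrite real_normK ?num_real.
nra.
Qed.

Lemma diam_ge0 (R : realType) n (U : set 'rV[R]_n) : (0 <= diam U)%E.
Proof. by apply: ereal_sup_ubound; left. Qed.

Lemma le_diam (R : realType) n (U : set 'rV[R]_n) x y : U x -> U y ->
  ((eucl_dist x y)%:E <= diam U)%E.
Proof.
by move=> Ux Uy; apply: ereal_sup_ubound; right; exists x => //; exists y.
Qed.

Lemma diam_le (R : realType) n (U : set 'rV[R]_n) (d : R) : 0 <= d ->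
  (forall x y, U x -> U y -> eucl_dist x y <= d) -> (diam U <= d%:E)%E.
Proof.
move=> d0 Ud; apply: ge_ereal_sup => _ [->|[x Ux [y Uy <-]]]; rewrite lee_fin//.
exact: Ud.
Qed.

Lemma eucl_dist_le_diam (R : realType) n (U : set 'rV[R]_n) (d : R) x y :
  (diam U <= d%:E)%E -> U x -> U y -> eucl_dist x y <= d.
Proof. by move=> Ud Ux Uy; rewrite -lee_fin (le_trans _ Ud)// le_diam. Qed.

Lemma eucl_dist_line (R : realType) n (i : 'I_n) (a : 'rV[R]_n) (r r' : R) :
  eucl_dist (a + r *: delta_mx ord0 i) (a + r' *: delta_mx ord0 i) = `|r - r'|.
Proof.
apply/eqP; rewrite -(@eqrXn2 _ 2) ?eucl_dist_ge0// real_normK ?num_real//.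
rewrite sqr_eucl_dist (bigD1 i)//= big1 ?addr0.
  by rewrite !mxE !eqxx !mulr1 (addrC (a _ _)) addrKA.
by move=> j ji; rewrite !mxE (negbTE ji) andbF !mulr0 subrr expr0n.
Qed.

(* The points [a + r e_0] within distance [d] of all of [A] are added; the
   largest such [r] is at distance exactly [d] from [A]. *)
Lemma diam_enlarge (R : realType) n (A : set 'rV[R]_n) (d : R) :
  (0 < n)%N -> 0 <= d -> (diam A <= d%:E)%E ->
  exists2 B, A `<=` B & diam B = d%:E.
Proof.
move=> n0 d0 Ad; pose i := Ordinal n0.
(* For an empty [A], a set built around the point 0 serves. *)
wlog [a Aa] : A Ad / exists a, A a.
  move=> wl; have [->|/set0P Ane] := eqVneq A set0; last exact: wl.
  have [||B _ dB] := wl [set 0].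
  - by apply: diam_le => // x y -> ->; rewrite eucl_distxx.
  - by exists 0.
  - by exists B.
pose p r := a + r *: delta_mx ord0 i.
pose G := [set r | 0 <= r /\ forall x, A x -> eucl_dist x (p r) <= d].
have G0 : G 0.
  split=> // x Ax; rewrite /p scale0r addr0; exact: eucl_dist_le_diam Ad _ _.
have pa : p 0 = a by rewrite /p scale0r addr0.
have Gd r : G r -> r <= d.
  move=> [r0 /(_ a Aa)]; rewrite -{1}pa eucl_dist_line sub0r normrN.
  by rewrite ger0_norm.
have supG : has_sup G by split; [exists 0 | exists d => r /Gd].
exists (A `|` p @` G); first by left.
apply/eqP; rewrite eq_le; apply/andP; split.
  apply: diam_le => // x y [Ax|[r [r0 Gr] <-]] [Ay|[r' [r'0 Gr'] <-]].
  - exact: eucl_dist_le_diam Ad _ _.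
  - exact: Gr'.
  - by rewrite eucl_distC; exact: Gr.
  - rewrite eucl_dist_line ler_norml; apply/andP; split.
      by rewrite lerNl opprB (le_trans _ (Gd _ (conj r'0 Gr')))// gerBl.
    by rewrite (le_trans _ (Gd _ (conj r0 Gr)))// gerBl.
apply/lee_addgt0Pr => e e0.
have e20 : 0 < e / 2 by rewrite divr_gt0.
have [r' Gr' r'e] := sup_adherent e20 supG.
have supG0 : 0 <= sup G by apply: sup_upper_bound.
(* Attainment of the supremum is avoided: just beyond it, some [x] in [A] is at distance more than
   [d], and moving back to [r'] in [G] loses at most [e]. *)
have : ~ G (sup G + e / 2).
  move=> /(sup_upper_bound supG); lra.
move=> /not_andP[|]; first by rewrite addr_ge0// ltW.
move=> /existsNP[x /not_implyP[Ax /negP]]; rewrite -ltNge => dx.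
have le2 : eucl_dist x (p (sup G + e / 2)) <= eucl_dist x (p r') + e.
  have -> : p (sup G + e / 2) = p r' + (sup G + e / 2 - r') *: delta_mx ord0 i.
    by rewrite /p -addrA -scalerDl subrKC.
  apply: (le_trans (eucl_dist_shift _ _ _ _)); rewrite lerD2l.
  have := sup_upper_bound supG Gr'; move=> r's; rewrite ger0_norm; lra.
have := @le_diam _ _ (A `|` p @` G) x (p r') (or_introl Ax)
  (or_intror (ex_intro2 _ _ r' Gr' erefl)).
move=> /(leeD2r e%:E); apply: le_trans; rewrite -EFinD lee_fin.
exact/ltW/(lt_le_trans dx).
Qed.

(** * Grid cells *)

(** Displacements between -2n and 2n in each coordinate, shifted by 2n to become natural numbers;
    there are (4n+1)^n of them. *)
Local Notation offset n := {ffun 'I_n -> 'I_(4 * n).+1}.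

Definition grid_label (R : realType) n (h : R) (x : 'rV[R]_n) : 'I_n -> int :=
  fun i => Num.floor (x ord0 i / h).

Lemma grid_label_dist (R : realType) n (h : R) (x y : 'rV[R]_n) : 0 < h ->
  grid_label h x = grid_label h y -> eucl_dist x y <= n%:R * h.
Proof.
move=> h0 xy; apply: eucl_dist_le_sup => [|i]; first exact: ltW.
have {1}-> : x ord0 i - y ord0 i = (x ord0 i / h - y ord0 i / h) * h.
  by rewrite -mulrBl divfK ?lt0r_neq0.
rewrite normrM (gtr0_norm h0) ger_pMl//.
have /(congr1 (@^~ i)) := xy; rewrite /grid_label => fl.
have := floor_itv (x ord0 i / h); have := floor_itv (y ord0 i / h).
rewrite -fl intrD ler_norml => /andP[y1 y2] /andP[x1 x2].
by apply/andP; split; lra.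
Qed.

(** After division by [h] the coordinates differ by at most 2n, hence so do their floors. A set of
    diameter at most 2nh thus meets only boundedly many cells, found from the cell of any of its
    points. *)
Lemma grid_label_near (R : realType) n (h : R) (x y : 'rV[R]_n) : 0 < h ->
  eucl_dist x y <= (2 * n)%:R * h ->
  exists q : offset n,
    grid_label h y = fun i => grid_label h x i + (q i)%:Z - (2 * n)%:Z.
Proof.
move=> h0 xy.
have fl i : (0 <= grid_label h y i - grid_label h x i + (2 * n)%:Z)
    && (grid_label h y i - grid_label h x i + (2 * n)%:Z <= (4 * n)%:Z).
  have : `|x ord0 i / h - y ord0 i / h| <= (2 * n)%:R.
    rewrite -mulrBl normrM normfV (gtr0_norm h0) ler_pdivrMr//.
    exact: le_trans (coord_le_eucl_dist _ _ _) xy.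
  rewrite /grid_label; move: (x _ _ / h) (y _ _ / h) => a b.
  rewrite ler_norml => /andP[ab1 ab2].
  have := floor_itv a; have := floor_itv b; rewrite !intrD.
  move: (Num.floor a) (Num.floor b) => A B /andP[b1 b2] /andP[a1 a2].
  have : (B%:~R : R) < (A + 1 + (2 * n)%:Z)%:~R by rewrite !intrD; lra.
  have : (A%:~R : R) < (B + 1 + (2 * n)%:Z)%:~R by rewrite !intrD; lra.
  rewrite !ltr_int; lia.
pose f i := absz (grid_label h y i - grid_label h x i + (2 * n)%:Z).
exists [ffun i => inord (f i)]; apply/funext => i; rewrite ffunE.
have := fl i => {fl} fl; rewrite inordK /f; lia.
Qed.

(** For an integer z, z <= a iff zp <= ap iff zp <= floor(ap), so floor(ap) determines floor(a).
    This makes dyadic cells nested. *)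
Lemma grid_label_refine (R : realType) n (h : R) (p : nat) (x y : 'rV[R]_n) :
  0 < h -> (0 < p)%N ->
  grid_label (h / p%:R) x = grid_label (h / p%:R) y ->
  grid_label h x = grid_label h y.
Proof.
move=> h0 p0 xy; apply/funext => i; have /(congr1 (@^~ i)) := xy.
have pR : 0 < p%:R :> R by rewrite ltr0n.
rewrite /grid_label !invf_div !(mulrA _ p%:R) !(mulrAC _ p%:R).
move: (x _ _ / h) (y _ _ / h) => {x y xy} a b.
suff H (a' b' : R) : Num.floor (a' * p%:R) = Num.floor (b' * p%:R) ->
    Num.floor a' <= Num.floor b'.
  by move=> ab; apply/eqP; rewrite eq_le !H.
move=> ab; rewrite floor_ge_int -(ler_pM2r pR) -(intrM _ _ p%:Z).
by rewrite -floor_ge_int -ab floor_ge_int intrM ler_pM2r// floor_le.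
Qed.

(** * Fractional covers *)

(** Turns countable sums into series, to which termwise integration applies; naturals that do not
    code an element of [J] contribute 0. *)
Lemma esum_countType (R : realType) (T : countType) (J : set T)
    (f : T -> \bar R) : (forall a, J a -> (0 <= f a)%E) ->
  \esum_(a in J) f a =
  (\sum_(k <oo) oapp (fun a => if a \in J then f a else 0) 0 (pickle_inv k))%E.
Proof.
move=> f0; pose g (k : nat) := oapp f 0%E (pickle_inv k).
rewrite nneseries_esumT; last first.
  by move=> k; case: pickle_inv => //= a; case: ifPn => // /set_mem /f0.
transitivity (\esum_(k in pickle @` J) g k).
  rewrite esum_image; first by apply: eq_esum => a _; rewrite /g pickleK_inv.
  by move=> a b _ _ /(pcan_inj (@pickleK_inv T)).
rewrite esum_mkcond; apply: eq_esum => k _; rewrite /g.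
have := @pickle_invK T k; case: pickle_inv => [a|] /= ak; last first.
  by case: ifPn.
rewrite -ak; congr (if _ then _ else _); apply/idP/idP => /set_mem.
  by move=> [b Jb /(pcan_inj (@pickleK_inv T)) <-]; exact: mem_set.
by move=> Ja; apply/mem_set; exists a.
Qed.

(** For uniform [t] in [0, 1[ the expected value of the random sum is at most the sum of the
    [c k * v k], hence below [y]; so not every [t] can give more than [y]. *)
Lemma average_indic (R : realType) (v c : nat -> R) (A : nat -> set R) (y : R) :
  (forall k, 0 <= v k) -> (forall k, measurable (A k)) ->
  (forall k, (lebesgue_measure (A k) <= (c k)%:E)%E) ->
  (\sum_(k <oo) (c k * v k)%:E < y%:E)%E ->
  exists2 t : R, 0 <= t < 1 & (\sum_(k <oo) (v k * \1_(A k) t)%:E <= y%:E)%E.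
Proof.
move=> v0 mA mAc cvy; apply: contrapT => /forall2NP H.
pose D : set R := [set` `[0%R, 1%R[].
have {}H t : D t -> (y%:E <= \sum_(k <oo) (v k * \1_(A k) t)%:E)%E.
  rewrite /D /= in_itv/= => t01; have [//|/negP] := H t.
  by rewrite -ltNge => /ltW.
move: cvy; apply/negP; rewrite -leNgt.
have mD : measurable D by exact: measurable_itv.
have <- : (\int[lebesgue_measure]_(t in D) (cst y%:E t) = y%:E)%E.
  by rewrite integral_cst//= lebesgue_measure_itv/= lte01 sube0 mule1.
have mf k : measurable_fun D (fun t => (v k * \1_(A k) t)%:E).
  by apply/measurable_EFinP; apply: measurable_funM => //; exact: measurable_indic.
have f0 k t : (0 <= (v k * \1_(A k) t)%:E)%E by rewrite lee_fin mulr_ge0.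
have cv0 k : 0 <= v k * c k.
  by rewrite mulr_ge0// -lee_fin (le_trans _ (mAc k)).
(* The comparison of integrals below wants nonnegative integrands; a negative [y] is trivial. *)
have [y0|y0] := leP 0 y; last first.
  apply: (@le_trans _ _ 0%E).
    rewrite integral_cst//= lebesgue_measure_itv/= lte01 sube0 mule1.
    by rewrite lee_fin ltW.
  by apply: nneseries_ge0 => k _ _; rewrite lee_fin mulrC.
apply: (@le_trans _ _
    (\int[lebesgue_measure]_(t in D) (\sum_(k <oo) (v k * \1_(A k) t)%:E))%E).
  apply: ge0_le_integral => //.
  - exact: (@ge0_emeasurable_sum _ _ _ D (fun k t => (v k * \1_(A k) t)%:E) xpredT).
rewrite integral_nneseries//; apply: lee_nneseries => k _.
  by move=> _; apply: integral_ge0 => t _.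
under eq_integral do rewrite EFinM.
rewrite ge0_integralZl//; last 2 first.
- apply/measurable_EFinP; apply: measurable_indic; exact: mA.
- by rewrite lee_fin.
rewrite integral_indic//; last exact: mA.
rewrite (mulrC (c k)) EFinM lee_wpmul2l ?lee_fin//.
apply: le_trans (mAc k); apply: le_measure; rewrite ?inE//; last exact: mA.
by apply: measurableI => //; exact: mA.
Qed.

Lemma average_esum (R : realType) (T : countType) (J : set T) (v c : T -> R)
    (A : T -> set R) (y : R) :
  (forall a, J a -> 0 <= v a) -> (forall a, J a -> 0 <= c a) ->
  (forall a, J a -> measurable (A a)) ->
  (forall a, J a -> (lebesgue_measure (A a) <= (c a)%:E)%E) ->
  (\esum_(a in J) (c a * v a)%:E < y%:E)%E ->
  exists2 t : R, 0 <= t < 1 &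
    (\esum_(a in J `&` [set a | A a t]) (v a)%:E <= y%:E)%E.
Proof.
move=> v0 c0 mA Ac cvy.
pose ext U (u0 : U) (u : T -> U) (k : nat) :=
  oapp (fun a => if a \in J then u a else u0) u0 (pickle_inv k).
have extP U (u0 : U) (u : T -> U) (P : U -> Prop) :
    P u0 -> (forall a, J a -> P (u a)) -> forall k, P (ext _ u0 u k).
  move=> Pu0 Pu k; rewrite /ext; case: pickle_inv => //= a.
  by case: ifPn => // /set_mem; exact: Pu.
have [||k||t t01 ty] := @average_indic R (ext _ 0 v) (ext _ 0 c) (ext _ set0 A) y.
- exact: (extP _ _ _ (fun r => 0 <= r)).
- exact: (extP _ _ _ (fun X => measurable X)).
- rewrite /ext; case: pickle_inv => [a|]/=; last by rewrite measure0.
  by case: ifPn => [/set_mem /Ac//|_]; rewrite measure0.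
- rewrite (le_lt_trans _ cvy)// esum_countType; last first.
    by move=> a Ja; rewrite lee_fin mulr_ge0 ?c0 ?v0.
  rewrite le_eqVlt; apply/orP; left; apply/eqP; apply: eq_eseriesr => k _.
  rewrite /ext; case: pickle_inv => [a|]/=; last by rewrite mul0r.
  by case: ifP => // _; rewrite mul0r.
exists t => //; apply: le_trans ty; rewrite esum_mkcondr esum_countType.
  rewrite le_eqVlt; apply/orP; left; apply/eqP; apply: eq_eseriesr => k _.
  rewrite /ext; case: pickle_inv => [a|]/=; last by rewrite mul0r.
  case: ifP => // _; last by rewrite mul0r.
  rewrite indicE (_ : (a \in [set a | A a t]) = (t \in A a)); last first.
    by apply/idP/idP => /set_mem ?; apply/mem_set.
  by case: (t \in A a); rewrite ?mulr1 ?mulr0.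
by move=> a Ja; case: ifP => // _; rewrite lee_fin v0.
Qed.

(** The left end will be a possibly infinite sum of weights; when it is [+oo] the set is empty. *)
Lemma lebesgue_measure_between (R : realType) (x : \bar R) (c : R) :
  (0 <= x)%E -> 0 <= c ->
  let A := [set t : R | (x <= t%:E < x + c%:E)%E] in
  measurable A /\ (lebesgue_measure A <= c%:E)%E.
Proof.
case: x => [r _ c0 A|_ c0 A|//].
  have -> : A = [set` `[r, r + c[].
    by apply/seteqP; split=> t; rewrite /A/= in_itv/= -EFinD lee_fin lte_fin.
  split; first exact: measurable_itv.
  rewrite lebesgue_measure_itv/= lte_fin; case: ifPn => _; last by rewrite lee_fin.
  by rewrite -EFinB lee_fin addrAC subrr add0r.
have -> : A = set0 by apply/seteqP; split=> t //=; rewrite leye_eq.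
by split => //; rewrite measure0.
Qed.

(* [rank_le] is a well-order of [T] in which coarser levels come first. *)
Definition rank_le (T : countType) (lev : T -> nat) (b a : T) : bool :=
  (lev b < lev a)%N || ((lev b == lev a) && (pickle b <= pickle a)%N).

Lemma rank_le_total (T : countType) (lev : T -> nat) : total (rank_le lev).
Proof. by move=> a b; rewrite /rank_le; lia. Qed.

Lemma rank_le_trans (T : countType) (lev : T -> nat) : transitive (rank_le lev).
Proof. by move=> a b c; rewrite /rank_le; lia. Qed.

Lemma rank_le_anti (T : countType) (lev : T -> nat) :
  antisymmetric (rank_le lev).
Proof.
move=> a b ab; apply: (pcan_inj (@pickleK T)); move: ab; rewrite /rank_le; lia.
Qed.

Lemma rank_le_lev (T : countType) (lev : T -> nat) a b :
  rank_le lev a b -> (lev a <= lev b)%N.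
Proof. by rewrite /rank_le; lia. Qed.

Lemma rank_min (T : countType) (lev : T -> nat) (P : set T) : P !=set0 ->
  exists2 a, P a & forall b, P b -> rank_le lev a b.
Proof.
move=> [a0 Pa0].
have minP (Q : set T) (f : T -> nat) : Q !=set0 ->
    exists2 a, Q a & forall b, Q b -> (f a <= f b)%N.
  move=> [a Qa]; have exf : exists n, `[< (f @` Q) n >].
    by exists (f a); apply/asboolP; exists a.
  have := ex_minnP exf => -[n /asboolP[b Qb <-] nmin].
  by exists b => // d Qd; apply: nmin; apply/asboolP; exists d.
have [a1 Pa1 a1min] := minP P lev (ex_intro _ _ Pa0).
have [|a [Pa alev] amin] := minP [set a | P a /\ lev a = lev a1] pickle.
  by exists a1.
exists a => // b Pb; rewrite /rank_le alev.
have := a1min b Pb; rewrite leq_eqVlt => /predU1P[ab|->//].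
by rewrite ab eqxx ltnn/= amin.
Qed.

Lemma rank_max (T : countType) (lev : T -> nat) (s : seq T) : s != [::] ->
  exists2 a, a \in s & forall b, b \in s -> rank_le lev b a.
Proof.
elim: s => // a s IH _; have [->|/IH[m ms mmax]] := eqVneq s [::].
  exists a; rewrite ?mem_head// => b; rewrite inE => /eqP ->.
  by have /orP[] := rank_le_total lev a a.
have /orP[am|ma] := rank_le_total lev a m.
  by exists m; rewrite ?inE ?ms ?orbT// => b; rewrite inE => /predU1P[->|/mmax].
exists a; rewrite ?mem_head// => b; rewrite inE => /predU1P[->|/mmax bm].
  by have /orP[] := rank_le_total lev a a.
exact: rank_le_trans bm ma.
Qed.

(* On the chain of the sets containing a point, list the weights in rank order
   as consecutive intervals starting at 0. For t in [0, 1[ the sets whose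
   interval contains t form a cover; its expected cost for uniform t is at most
   the weighted cost. *)
Lemma weighted_cover_selection (R : realType) (X : Type) (E : set X)
    (T : countType) (J : set T) (Q : T -> set X) (lev : T -> nat)
    (c v : T -> R) (y : R) :
  (forall a, J a -> 0 <= c a) -> (forall a, J a -> 0 <= v a) ->
  (forall a b, J a -> J b -> (lev b <= lev a)%N -> Q a `&` Q b !=set0 ->
    Q a `<=` Q b) ->
  (forall x, E x -> (1 <= \esum_(a in J `&` [set a | Q a x]) (c a)%:E)%E) ->
  (\esum_(a in J) (c a * v a)%:E < y%:E)%E ->
  exists J' : set T, [/\ J' `<=` J, E `<=` \bigcup_(a in J') Q a &
    (\esum_(a in J') (v a)%:E <= y%:E)%E].
Proof.
move=> c0 v0 nested cov cvy.
(* The definition refers to no point. By nestedness the earlier sets meeting [Q a] contain it, so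
   over any point of [Q a] they are exactly the earlier members of the chain. *)
pose before a := J `&` [set b | (b != a) && rank_le lev b a]
  `&` [set b | Q a `&` Q b !=set0].
pose S a : \bar R := \esum_(b in before a) (c b)%:E.
pose A a := [set t : R | (S a <= t%:E < S a + (c a)%:E)%E].
have S0 a : (0 <= S a)%E by apply: esum_ge0 => b [[Jb _] _]; rewrite lee_fin c0.
have [||a Ja|a Ja|t /andP[t0 t1] ty] := @average_esum R T J v c A y _ _ _ _ cvy.
- exact: v0.
- exact: c0.
- exact: (lebesgue_measure_between (S0 a) (c0 a Ja)).1.
- exact: (lebesgue_measure_between (S0 a) (c0 a Ja)).2.
exists (J `&` [set a | A a t]); split; [by move=> a []| |exact: ty].
move=> x Ex; pose Jx := J `&` [set a | Q a x].
have beforeE a : Jx a ->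
    before a = Jx `&` [set b | (b != a) && rank_le lev b a].
  move=> [Ja Qax]; apply/seteqP; split=> b.
    move=> [[Jb /=/andP[ba rba]] Qab]; split; last by rewrite /= ba.
    by split => //; exact: (nested a b Ja Jb (rank_le_lev rba) Qab).
  by move=> [[Jb Qbx] /= rba]; split => //; exists x.
(* The last member [b] of [Y] works: all the others precede it, so their weights are part of
   [S b]. *)
have big_sum Y : finite_set Y -> Y `<=` Jx ->
    (t%:E < \sum_(a \in Y) (c a)%:E)%E ->
    exists2 b, Y b & (t%:E < S b + (c b)%:E)%E.
  move=> finY YJ tY.
  have Y0 : finmap.enum_fset (fset_set Y) != [::].
    apply: contraTneq tY => Y0; rewrite fsbig_finite//= Y0 big_nil -leNgt.
    by rewrite lee_fin.
  have [b + bmax] := rank_max lev Y0; rewrite in_fset_set// => /set_mem Yb.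
  exists b => //; apply: (lt_le_trans tY).
  rewrite (fsbigD1 b)//=.
  rewrite addeC leeD2r//; apply: esum_ge; exists (Y `\ b) => //.
  split; first exact: finite_setD.
  move=> d [Yd /eqP db]; rewrite beforeE; last exact: YJ.
  split; [exact: YJ|rewrite /= db/= bmax// in_fset_set//; exact/mem_set].
have : (t%:E < \esum_(a in Jx) (c a)%:E)%E.
  by rewrite (lt_le_trans _ (cov x Ex))// lte_fin.
move=> /ereal_sup_gt[_ [Y [finY YJ] <-] tY].
have [b Yb tb] := big_sum Y finY YJ tY.
(* [a] is the first set of the chain whose interval ends beyond [t]. If the interval also began
   beyond [t], finitely many earlier sets would have total weight above [t], and [big_sum] would
   give an earlier choice. *)
have [|a [Jxa ta] amin] :=
    @rank_min T lev [set a | Jx a /\ (t%:E < S a + (c a)%:E)%E].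
  by exists b; split => //; exact: YJ.
exists a; last exact: Jxa.2.
split; first exact: Jxa.1.
rewrite /A/= ta andbT leNgt; apply/negP => /ereal_sup_gt[_ [Z [finZ Zbef] <-] tZ].
have ZJ : Z `<=` Jx by move=> z /Zbef; rewrite beforeE// => -[].
have [d Zd td] := big_sum Z finZ ZJ tZ.
have := Zbef d Zd; rewrite beforeE// => -[Jxd /=/andP[/eqP da rda]].
by apply: da; apply: (@rank_le_anti _ lev); rewrite rda amin.
Qed.

(** * Covers by families with prescribed diameters *)

Lemma lower_scale_ge0 (R : realType) (theta delta : R) :
  0 <= lower_scale theta delta.
Proof. by rewrite /lower_scale; case: ifP => // _; exact: powR_ge0. Qed.

(** Upper bounds [d a] on the diameters suffice, since each [V a] can be enlarged to diameter
    exactly [d a]; only these values have to lie in the allowed range. *)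
Lemma has_cover_family (R : realType) (n : nat) (theta s delta eps : R)
    (F : set 'rV[R]_n) (T : countType) (J : set T) (V : T -> set 'rV[R]_n)
    (d : T -> R) :
  (0 < n)%N -> F `<=` \bigcup_(a in J) V a ->
  (forall a, J a -> (diam (V a) <= (d a)%:E)%E) ->
  (forall a, J a -> lower_scale theta delta <= d a <= delta) ->
  (\esum_(a in J) (d a `^ s)%:E <= eps%:E)%E ->
  has_cover theta F s delta eps.
Proof.
move=> n0 FV Vd dle sum.
have /choice[B BP] a : exists B, J a -> V a `<=` B /\ diam B = (d a)%:E.
  have [Ja|nJa] := pselect (J a); last by exists set0.
  have [|B VB dB] := diam_enlarge n0 _ (Vd a Ja); last by exists B.
  by have /andP[+ _] := dle a Ja; apply: le_trans; exact: lower_scale_ge0.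
exists (pickle @` J), (fun k => oapp B set0 (pickle_inv k)); split.
- move=> x /FV[a Ja Vax]; exists (pickle a); first by exists a.
  by rewrite pickleK_inv; exact: (BP a Ja).1.
- by move=> _ [a Ja <-]; rewrite pickleK_inv/= (BP a Ja).2 !lee_fin dle.
- rewrite esum_image; last by move=> a b _ _ /(pcan_inj (@pickleK_inv T)).
  apply: le_trans sum; apply: le_esum => a Ja.
  by rewrite pickleK_inv/= (BP a Ja).2 poweR_EFin.
Qed.

Lemma has_coverE (R : realType) (n : nat) (theta s delta eps : R)
    (F : set 'rV[R]_n) :
  has_cover theta F s delta eps ->
  exists (I : set nat) (U : nat -> set 'rV[R]_n) (d : nat -> R),
    [/\ F `<=` \bigcup_(i in I) U i,
        forall i, I i -> diam (U i) = (d i)%:E,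
        forall i, I i -> lower_scale theta delta <= d i <= delta
      & (\esum_(i in I) (d i `^ s)%:E <= eps%:E)%E].
Proof.
move=> [I [U [FU dU sum]]]; exists I, U, (fun i => fine (diam (U i))).
have dE i : I i -> diam (U i) = (fine (diam (U i)))%:E.
  move=> Ii; rewrite fineK// fin_real//; have /andP[_ dU1] := dU i Ii.
  by rewrite (lt_le_trans _ (diam_ge0 _))//= (le_lt_trans dU1)// ltry.
split => // [i Ii|]; first by rewrite -!lee_fin -dE//; exact: dU.
apply: le_trans sum; by apply: le_esum => i Ii; rewrite -poweR_EFin -dE.
Qed.

Lemma esum_subset (R : realType) (T : choiceType) (A B : set T)
    (f : T -> \bar R) : A `<=` B ->
  (\esum_(i in A) f i <= \esum_(i in B) f i)%E.
Proof.
move=> AB; apply: ereal_sup_le => _ [X [finX XA] <-]; exists X => //.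
by split => //; exact: subset_trans AB.
Qed.

Lemma esumZl (R : realType) (T : choiceType) (A : set T) (r : R)
    (f : T -> \bar R) : 0 < r -> (forall i, (0 <= f i)%E) ->
  (\esum_(i in A) (r%:E * f i) = r%:E * \esum_(i in A) f i)%E.
Proof.
move=> r0 f0; rewrite /esum -ereal_sup_pZl// image_comp; congr ereal_sup.
apply: eq_imagel => X [finX _] /=; rewrite !fsbig_finite//=.
by rewrite ge0_sume_distrr.
Qed.

(** Counts the cost when each set is replaced by a finite list of pieces of equal cost. *)
Lemma esum_seq_fibers (R : realType) (T U : choiceType) (A : set T)
    (K : T -> seq U) (f : T -> \bar R) :
  (forall i, uniq (K i)) -> (forall i, A i -> (0 <= f i)%E) ->
  (\esum_(a in [set a : T * U | A a.1 /\ a.2 \in K a.1]) f a.1 =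
   \esum_(i in A) ((size (K i))%:R%:E * f i))%E.
Proof.
move=> uK f0.
rewrite -(@esum_esum _ _ _ A (fun i => [set` K i]) (fun i _ => f i)); last first.
  by move=> i _ Ai _; exact: f0.
apply: eq_esum => i Ai; rewrite esum_fset//; last first.
  by move=> *; exact: f0.
by rewrite -fsbig_seq//= big_const_seq count_predT iter_addr_0 mule_natl.
Qed.

(** At this mesh a cell has diameter at most [d], while a set of diameter [d] stays within the 2n
    mesh widths allowed by [grid_label_near]. *)
Lemma dyadic_scale (R : realType) (n : nat) (d : R) : (0 < n)%N -> 0 < d <= 1 ->
  exists k, n%:R * (1 / (2 ^ k)%:R) <= d <= (2 * n)%:R * (1 / (2 ^ k)%:R).
Proof.
move=> n0 /andP[d0 d1].
have p2 k : 0 < (2 ^ k)%:R :> R by rewrite ltr0n expn_gt0.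
have ex : exists k, n%:R * (1 / (2 ^ k)%:R) <= d.
  exists (Num.bound (n%:R / d)); rewrite mul1r ler_pdivrMr//.
  rewrite -ler_pdivrMl// mulrC; apply/ltW.
  apply: lt_le_trans (archi_boundP _) _; first by rewrite divr_ge0// ltW.
  by rewrite ler_nat ltnW// ltn_expl.
have := ex_minnP ex => -[k kd kmin]; exists k; rewrite kd/=.
(* By minimality of [k] the previous mesh is too large; for k = 0 the upper bound comes from d <= 1
   <= 2n. *)
case: k kd kmin => [|k] kd kmin.
  rewrite (le_trans d1)// expn0 divr1 mulr1 -[leLHS]/(1%:R) ler_nat; lia.
have /contraNN := kmin k; rewrite -ltnNge ltnSn => /(_ isT).
rewrite -ltNge => /ltW /le_trans; apply.
by rewrite expnS !mul1r !natrM invfM mulrACA mulfV ?pnatr_eq0// mul1r.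
Qed.

Lemma powR_le1_anti (R : realType) (d s s' : R) : 0 <= d <= 1 -> 0 <= s <= s' ->
  d `^ s' <= d `^ s.
Proof.
move=> /andP[]; rewrite le_eqVlt => /predU1P[<- _|d0 d1] /andP[s0 ss']; last first.
  by rewrite ger_powR// d0.
(* At base 0 the power is 1 for exponent 0 and 0 otherwise; [s' = 0] forces [s = 0]. *)
have [s'0|/powR0 ->] := eqVneq s' 0; last exact: powR_ge0.
by have -> : s = s' by lra.
Qed.

Lemma has_cover_le (R : realType) (n : nat) (theta s s' delta eps : R)
    (F : set 'rV[R]_n) : (0 < n)%N -> 0 <= s <= s' -> delta <= 1 ->
  has_cover theta F s delta eps -> has_cover theta F s' delta eps.
Proof.
move=> n0 ss' delta1 /has_coverE[I [U [d [FU Ud dle sum]]]].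
apply: (has_cover_family n0 FU _ dle) => [i Ii|]; first by rewrite Ud.
apply: le_trans sum; apply: le_esum => i Ii; rewrite lee_fin powR_le1_anti//.
have /andP[+ d2] := dle i Ii; rewrite (le_trans d2)// andbT.
by apply: le_trans; exact: lower_scale_ge0.
Qed.

(** * Admissible exponents *)

Definition lower_admissible (R : realType) (n : nat) (theta : R)
    (F : set 'rV[R]_n) : set R :=
  [set s : R | 0 <= s /\ forall eps delta0 : R, 0 < eps -> 0 < delta0 ->
    exists2 delta : R, 0 < delta <= delta0 & has_cover theta F s delta eps].

Definition upper_admissible (R : realType) (n : nat) (theta : R)
    (F : set 'rV[R]_n) : set R :=
  [set s : R | 0 <= s /\ forall eps : R, 0 < eps ->
    exists2 delta0 : R, 0 < delta0 &
      forall delta : R, 0 < delta <= delta0 -> has_cover theta F s delta eps].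

(** Once the scale is capped at 1, all diameters are at most 1 and a larger exponent cannot increase
    the sum. *)
Lemma lower_admissible_le (R : realType) (n : nat) (theta : R)
    (F : set 'rV[R]_n) (s s' : R) : (0 < n)%N -> s <= s' ->
  lower_admissible theta F s -> lower_admissible theta F s'.
Proof.
move=> n0 ss' [s0 adm]; split; first exact: le_trans ss'.
move=> eps delta0 eps0 delta00.
have [|delta /andP[d0 d1] cov] := adm eps (Num.min delta0 1) eps0.
  by rewrite lt_min delta00 ltr01.
move: d1; rewrite le_min => /andP[d1 d2].
exists delta; first by rewrite d0.
by apply: has_cover_le cov => //; rewrite s0.
Qed.

Lemma upper_admissible_le (R : realType) (n : nat) (theta : R)
    (F : set 'rV[R]_n) (s s' : R) : (0 < n)%N -> s <= s' ->
  upper_admissible theta F s -> upper_admissible theta F s'.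
Proof.
move=> n0 ss' [s0 adm]; split; first exact: le_trans ss'.
move=> eps eps0; have [delta0 d0 cov] := adm eps eps0.
exists (Num.min delta0 1); first by rewrite lt_min d0 ltr01.
move=> delta /andP[d1]; rewrite le_min => /andP[d2 d3].
by apply: has_cover_le (cov delta _) => //; rewrite ?s0 ?d1.
Qed.

Lemma lower_upper_admissible (R : realType) (n : nat) (theta : R)
    (F : set 'rV[R]_n) (s : R) :
  upper_admissible theta F s -> lower_admissible theta F s.
Proof.
move=> [s0 adm]; split=> // eps delta0 eps0 delta00.
have [delta1 d1 cov] := adm eps eps0.
exists (Num.min delta0 delta1); last apply: cov.
  by rewrite lt_min delta00 d1/= ge_min lexx.
by rewrite lt_min delta00 d1/= ge_min lexx orbT.
Qed.

Lemma lower_dim_ge0 (R : realType) (n : nat) (theta : R) (F : set 'rV[R]_n) :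
  (0 <= lower_dim theta F)%E.
Proof. by apply: le_ereal_inf_tmp => _ [s [s0 _] <-]; rewrite lee_fin. Qed.

Lemma upper_dim_ge0 (R : realType) (n : nat) (theta : R) (F : set 'rV[R]_n) :
  (0 <= upper_dim theta F)%E.
Proof. by apply: le_ereal_inf_tmp => _ [s [s0 _] <-]; rewrite lee_fin. Qed.

Lemma lower_dim_le (R : realType) (n : nat) (theta : R) (F : set 'rV[R]_n)
    (s : R) : lower_admissible theta F s -> (lower_dim theta F <= s%:E)%E.
Proof. by move=> adm; apply: ereal_inf_lbound; exists s. Qed.

(** * Slices and projections of covers of a product *)

(** Slicing at a fixed point of [F] does not increase the cost. With its counterpart for [F], this
    bounds both lower dimensions by every exponent admissible for the product. *)
Lemma lower_admissible_prodl (R : realType) (n m : nat) (theta : R)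
    (E : set 'rV[R]_n) (F : set 'rV[R]_m) (s : R) : (0 < n)%N -> F !=set0 ->
  lower_admissible theta (row_prod E F) s -> lower_admissible theta E s.
Proof.
move=> n0 [y0 Fy0] [s0 adm]; split => // eps delta0 eps0 delta00.
have [delta dd /has_coverE[I [W [d [EFW Wd dle sum]]]]] :=
  adm eps delta0 eps0 delta00.
exists delta => //.
apply: (has_cover_family (V := fun i => [set x | W i (row_mx x y0)]) n0 _ _ dle sum).
  by move=> x Ex; apply: EFW; exists x => //; exists y0.
move=> i Ii; apply: diam_le => [|x x' Wx Wx'].
  by have /andP[+ _] := dle i Ii; apply: le_trans; exact: lower_scale_ge0.
apply: le_trans (eucl_dist_row_mxl x x' y0 y0) _.
by apply: (@eucl_dist_le_diam _ _ (W i)) => //; rewrite Wd.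
Qed.

(** Only the [W i] that meet the slice over [x] are needed to cover [F]. Used in contrapositive
    form: if [F] has no cover of cost [eps], these sets cost more than [eps] for every [x] in
    [E]. *)
Lemma has_cover_slice (R : realType) (n m : nat) (theta s delta eps : R)
    (E : set 'rV[R]_n) (F : set 'rV[R]_m) (x : 'rV[R]_n) (I : set nat)
    (W : nat -> set 'rV[R]_(n + m)) (d : nat -> R) :
  (0 < m)%N -> E x -> row_prod E F `<=` \bigcup_(i in I) W i ->
  (forall i, I i -> diam (W i) = (d i)%:E) ->
  (forall i, I i -> lower_scale theta delta <= d i <= delta) ->
  (\esum_(i in I `&` [set i | exists y, W i (row_mx x y)]) (d i `^ s)%:E
     <= eps%:E)%E ->
  has_cover theta F s delta eps.
Proof.
move=> m0 Ex EFW Wd dle sum.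
apply: (has_cover_family (V := fun i => [set y | W i (row_mx x y)]) m0 _ _ _ sum).
- move=> y Fy; have [|i Ii Wi] := EFW (row_mx x y).
    by exists x => //; exists y.
  by exists i => //; split => //; exists y.
- move=> i [Ii _]; apply: diam_le => [|y y' Wy Wy'].
    by have /andP[+ _] := dle i Ii; apply: le_trans; exact: lower_scale_ge0.
  apply: le_trans (eucl_dist_row_mxr x x y y') _.
  by apply: (@eucl_dist_le_diam _ _ (W i)) => //; rewrite Wd.
- by move=> i [Ii _]; exact: dle.
Qed.

Lemma lower_admissible_prodr (R : realType) (n m : nat) (theta : R)
    (E : set 'rV[R]_n) (F : set 'rV[R]_m) (s : R) : (0 < m)%N -> E !=set0 ->
  lower_admissible theta (row_prod E F) s -> lower_admissible theta F s.
Proof.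
move=> m0 [x0 Ex0] [s0 adm]; split => // eps delta0 eps0 delta00.
have [delta dd /has_coverE[I [W [d [EFW Wd dle sum]]]]] :=
  adm eps delta0 eps0 delta00.
exists delta => //; apply: (has_cover_slice m0 Ex0 EFW Wd dle).
by apply: le_trans sum; apply: esum_subset => i [].
Qed.

(** If [t] fails for [F], at all small scales every slice costs more than a fixed [epsF]. The
    weights d^t / epsF then cover [E] fractionally, and their cost for the exponent [s] is a
    multiple of the sum of the d^(s+t). *)
Lemma lower_admissible_split (R : realType) (n m : nat) (theta s t : R)
    (E : set 'rV[R]_n) (F : set 'rV[R]_m) :
  (0 < n)%N -> (0 < m)%N -> 0 <= s -> 0 < t ->
  lower_admissible theta (row_prod E F) (s + t) ->
  lower_admissible theta E s \/ lower_admissible theta F t.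
Proof.
move=> n0 m0 s0 t0 [_ adm].
have [|nF] := pselect (lower_admissible theta F t); [by right|left].
split=> // eps delta0 eps0 delta00.
have [epsF [deltaF [epsF0 deltaF0 nFcov]]] : exists epsF deltaF,
    [/\ 0 < epsF, 0 < deltaF & forall delta, 0 < delta <= deltaF ->
      ~ has_cover theta F t delta epsF].
  apply: contrapT => H; apply: nF; split; first exact: ltW.
  move=> e d e0 d0; apply: contrapT => /forall2NP H2; apply: H; exists e, d.
  by split => // delta dd; have [|] := H2 delta.
pose M : R := (size (enum (offset n)))%:R.
have M0 : 0 < M.
  rewrite ltr0n -cardE; apply/card_gt0P; by exists [ffun=> ord0].
(* [M] pays for the cells that replace each projection, [epsF] for the normalisation of the weights,
   and 2 for the strict inequality in the selection lemma. *)
have [||delta /andP[delta_gt0]] :=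
    adm (eps * epsF / (2 * M)) (Num.min delta0 (Num.min deltaF 1)).
- by rewrite divr_gt0// mulr_gt0.
- by rewrite !lt_min delta00 deltaF0/=.
rewrite !le_min => /and3P[delta1 delta2 delta3].
move=> /has_coverE[I [W [d [EFW Wd dle sum]]]].
exists delta; first by rewrite delta_gt0.
(* Null diameters, possible when [theta] is 0, have no dyadic scale; as [t > 0] they add nothing to
   the cost of a slice. *)
pose J := I `&` [set i | 0 < d i].
have d_gt0 i : J i -> 0 < d i <= 1.
  by move=> [Ii /= ->]/=; have /andP[_ /le_trans] := dle i Ii; apply.
have /choice[k kP] i : exists k : nat, J i ->
    n%:R * (1 / (2 ^ k)%:R) <= d i <= (2 * n)%:R * (1 / (2 ^ k)%:R).
  have [Ji|nJi] := pselect (J i); last by exists 0%N.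
  by have [k kP] := dyadic_scale n0 (d_gt0 i Ji); exists k.
have /choice[w wP] i : exists w, W i !=set0 -> W i w.
  have [[w Wiw]|nW] := pselect (W i !=set0); [by exists w|by exists 0].
pose h l : R := 1 / (2 ^ l)%:R.
have h0 l : 0 < h l by rewrite divr_gt0// ltr0n expn_gt0.
pose T := (nat * (offset n))%type.
pose JT := [set a : T | J a.1 /\ a.2 \in enum (offset n)].
have JTE a : JT a = J a.1 by rewrite /JT/= mem_enum; apply/propext; split=> [[]|].
(* The cells around that of the projected reference point [w i]; together they cover the projection
   of [W i]. *)
pose Q (a : T) := [set x | grid_label (h (k a.1)) x = fun i =>
  grid_label (h (k a.1)) (lsubmx (w a.1)) i + (a.2 i)%:Z - (2 * n)%:Z].
have [|||||J' [J'J EJ' sumJ']] := @weighted_cover_selection R _ E T JT Q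
    (fun a => k a.1) (fun a => d a.1 `^ t / epsF) (fun a => d a.1 `^ s) eps.
- by move=> a _; rewrite divr_ge0 ?powR_ge0// ltW.
- by move=> a _; rewrite powR_ge0.
- move=> a b _ _ kba [z [Qaz Qbz]] x Qax; rewrite /Q/= -Qbz.
  have hE : h (k a.1) = h (k b.1) / (2 ^ (k a.1 - k b.1))%:R.
    by rewrite /h -[in LHS](subnKC kba) expnD natrM invfM mulrA.
  apply: (@grid_label_refine _ _ _ (2 ^ (k a.1 - k b.1))) => //.
    by rewrite expn_gt0.
  by rewrite -hE Qax -Qaz.
- move=> x Ex.
  have ltx : (epsF%:E < \esum_(i in I `&` [set i | exists y, W i (row_mx x y)])
      (d i `^ t)%:E)%E.
    rewrite ltNge; apply/negP => lex; apply: (nFcov delta).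
      by rewrite delta_gt0.
    exact: has_cover_slice m0 Ex EFW Wd dle lex.
  pose Jx := J `&` [set i | exists y, W i (row_mx x y)].
  have JxE : (\esum_(i in I `&` [set i | exists y, W i (row_mx x y)])
      (d i `^ t)%:E = \esum_(i in Jx) (d i `^ t)%:E)%E.
    rewrite /Jx /J -setIA (setIC [set i | 0 < d i]) setIA [RHS]esum_mkcondr.
    apply: eq_esum => i [Ii _]; case: ifPn => //.
    move=> /negP di; have -> : d i = 0; last by rewrite powR0// gt_eqF.
    apply/eqP; rewrite eq_le; have /andP[+ _] := dle i Ii.
    move=> /(le_trans (lower_scale_ge0 _ _)) ->; rewrite andbT leNgt.
    by apply/negP => di0; apply: di; exact/mem_set.
  have /choice[q qP] i : exists q, Jx i -> Q (i, q) x.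
    have [[Ji [y Wixy]]|] := pselect (Jx i); last by exists [ffun=> ord0].
    have [|q Eq] := @grid_label_near _ _ (h (k i)) (lsubmx (w i)) x (h0 _).
      have /andP[_ dk] := kP i Ji; apply: le_trans dk.
      apply: le_trans (eucl_dist_row_mxl _ _ (rsubmx (w i)) y) _.
      rewrite hsubmxK; apply: (@eucl_dist_le_diam _ _ (W i)) => //.
        by rewrite Wd//; exact: Ji.1.
      by apply: wP; exists (row_mx x y).
    by exists q.
  (* One cell containing [x] for each index is enough: distinct indices give distinct pairs, whose
     weights already sum to at least 1. *)
  apply: (@le_trans _ _ (\esum_(a in (fun i => (i, q i) : T) @` Jx)
    (d a.1 `^ t / epsF)%:E)); last first.
    apply: esum_subset => _ [i Jxi <-]; split; last exact: qP.
    by rewrite JTE; exact: Jxi.1.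
  rewrite esum_image/=; last by move=> i j _ _ [].
  rewrite (eq_esum (b := fun i => (epsF^-1%:E * (d i `^ t)%:E)%E)); last first.
    by move=> i _; rewrite mulrC EFinM.
  rewrite esumZl ?invr_gt0//; last by move=> i; rewrite lee_fin powR_ge0.
  by rewrite lee_pdivlMl// mule1 -JxE ltW.
- have -> : \esum_(a in JT) ((d a.1 `^ t / epsF) * d a.1 `^ s)%:E =
      \esum_(i in J) ((M / epsF)%:E * (d i `^ (s + t))%:E)%E.
    have -> := @esum_seq_fibers R nat _ J
        (fun=> enum (offset n))
        (fun i => ((d i `^ t / epsF) * d i `^ s)%:E).
    - apply: eq_esum => i [_ /= di]; rewrite -!EFinM powRD; last first.
        by apply/implyP => _; rewrite gt_eqF.
      by congr EFin; rewrite -/M; ring.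
    - by move=> _; exact: enum_uniq.
    - by move=> i _; rewrite lee_fin mulr_ge0 ?divr_ge0 ?powR_ge0// ltW.
  rewrite esumZl ?divr_gt0//; last by move=> i; rewrite lee_fin powR_ge0.
  apply: (@le_lt_trans _ _ ((M / epsF)%:E * (eps * epsF / (2 * M))%:E)%E).
    apply: lee_wpmul2l; first by rewrite lee_fin divr_ge0// ltW.
    by apply: le_trans sum; apply: esum_subset => i [].
  rewrite -EFinM lte_fin [ltLHS](_ : _ = eps / 2); first by lra.
  by field; rewrite !gt_eqF.
(* A cell at level [k i] has diameter at most [d i]; it is raised to this value, which is in range
   because it comes from the original cover. *)
apply: (has_cover_family (J := J') (V := Q) (d := fun a => d a.1)) => //.
- move=> a /J'J Ja; move: (Ja); rewrite JTE => /[dup] Ja1 /kP/andP[nd _].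
  apply: diam_le => [|x y Qx Qy].
    by have /andP[/ltW] := d_gt0 _ Ja1.
  apply: le_trans nd; apply: grid_label_dist => //.
  by move: Qx Qy; rewrite /Q/= => -> ->.
- by move=> a /J'J [[/dle]].
Qed.

(** * The upper box dimension *)

Lemma at_right0E (R : realType) (V : set R) : (0 : R)^'+ V ->
  exists2 rho : R, 0 < rho < 1 & forall d, 0 < d < rho -> V d.
Proof.
(* Keeping [rho] below 1 makes [- ln d] positive for all [d] below it. *)
move=> /nbhs_ballP[e /= e0 eV]; exists (Num.min e (1 / 2)).
  by rewrite lt_min e0 gt_min divr_gt0//=; apply/orP; right; lra.
move=> d /andP[d0]; rewrite lt_min => /andP[de _].
by apply: eV => //; rewrite /ball/= sub0r normrN gtr0_norm.
Qed.

Lemma covering_number_ge1 (R : realType) (n : nat) (F : set 'rV[R]_n) (d : R) :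
  F !=set0 -> (1 <= covering_number F d)%E.
Proof.
move=> [x Fx]; apply: le_ereal_inf_tmp => _ [[|k] [U [FU _]] <-].
  by have [[]] := FU x Fx.
by rewrite lee_fin ler1n.
Qed.

Lemma upper_box_dim_ge0 (R : realType) (n : nat) (F : set 'rV[R]_n) :
  F !=set0 -> (0 <= upper_box_dim F)%E.
Proof.
move=> F0; apply: le_ereal_inf_tmp => _ [V /at_right0E[rho /andP[r0 r1] HV] <-].
have r20 : 0 < rho / 2 by rewrite divr_gt0.
apply: le_ereal_sup_tmp; eexists; first by exists (rho / 2); [apply: HV; lra|].
rewrite mule_ge0 ?lne_ge0 ?covering_number_ge1// lee_fin invr_ge0 oppr_ge0.
by apply: ln_le0; lra.
Qed.

(** A limsup below [t] gives N_d(F) < d^(-t) for all small d; as N_d(F) is an infimum, some finite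
    cover has fewer than d^(-t) members. *)
Lemma upper_box_dim_cover (R : realType) (n : nat) (F : set 'rV[R]_n) (t : R) :
  F !=set0 -> (upper_box_dim F < t%:E)%E ->
  exists2 rho : R, 0 < rho & forall d, 0 < d < rho ->
    exists (k : nat) (V : nat -> set 'rV[R]_n),
      [/\ F `<=` \bigcup_(j in `I_k) V j,
          forall j, (j < k)%N -> (diam (V j) <= d%:E)%E
        & k%:R <= d `^ (- t)].
Proof.
move=> F0 /ereal_inf_lt[_ [V /at_right0E[rho /andP[r0 r1] HV] <-] supV].
exists rho => // d /andP[d0 dr].
have lnd : 0 < - ln d by rewrite oppr_gt0 ln_lt0// d0 (lt_trans dr).
have : (lne (covering_number F d) * ((- ln d)^-1)%:E < t%:E)%E.
  apply: le_lt_trans supV; apply: ereal_sup_ubound; exists d => //.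
  by apply: HV; rewrite d0.
rewrite lte_pdivrMr// -lte_expeR -EFinM/=.
have N1 := covering_number_ge1 d F0.
have lneE : expeR (lne (covering_number F d)) = covering_number F d.
  by apply/eqP; rewrite lneK_eq (le_trans _ N1).
rewrite lneE => /ereal_inf_lt[_ [k [U [FU dU]] <-]]; rewrite lte_fin => kd.
exists k, (fun j => oapp U set0 (insub j)); split.
- by move=> x /FU[j _ Uj]; exists j; rewrite /= ?ltn_ord// valK.
- by move=> j jk; rewrite insubT; exact: dU.
- by rewrite /powR gt_eqF// mulNr -mulrN ltW.
Qed.

(** * Covers of a product built from covers of its factors *)

Lemma esum_geometric (R : realType) (I : set nat) (e : R) : 0 <= e ->
  (\esum_(i in I) (e / (2 ^ i.+1)%:R)%:E <= e%:E)%E.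
Proof.
move=> e0; apply: le_trans (epsilon_trick0 xpredT e0).
rewrite nneseries_esumT; last by move=> i; rewrite lee_fin divr_ge0.
exact: esum_subset.
Qed.

(** A set of diameter e yields O(e^(-t)) products of diameter at most e, so their total cost for the
    exponent [s + t] is O(e^s). Since [s > 0], null diameters can be made positive at arbitrarily
    small cost. *)
Lemma upper_admissible_prod (R : realType) (n m : nat) (theta s t rho : R)
    (E : set 'rV[R]_n) (F : set 'rV[R]_m) :
  (0 < n)%N -> 0 < s -> 0 <= t -> 0 < rho ->
  (forall d, 0 < d < rho -> exists (k : nat) (V : nat -> set 'rV[R]_m),
      [/\ F `<=` \bigcup_(j in `I_k) V j,
          forall j, (j < k)%N -> (diam (V j) <= d%:E)%E
        & k%:R <= d `^ (- t)]) ->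
  upper_admissible theta E s ->
  upper_admissible theta (row_prod E F) (s + t).
Proof.
move=> n0 s0 t0 rho0 boxF [_ adm].
split=> [|eps eps0]; first by rewrite addr_ge0// ltW.
have nR : 0 < n%:R :> R by rewrite ltr0n.
pose M : R := (size (enum (offset n)))%:R.
have M0 : 0 < M.
  rewrite ltr0n -cardE; apply/card_gt0P; by exists [ffun=> ord0].
have t20 : 0 < 2 `^ t :> R by rewrite powR_gt0.
(* [M * 2 ^ t] is the constant lost in passing to products; the 2 pays for the enlarged
   diameters. *)
pose eps' := eps / (2 * (M * 2 `^ t)).
have eps'0 : 0 < eps' by rewrite divr_gt0// !mulr_gt0.
have [delta0 delta00 cov] := adm eps' eps'0.
exists (Num.min delta0 rho); first by rewrite lt_min delta00.
move=> delta /andP[delta_gt0]; rewrite le_min => /andP[delta1 delta2].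
have [|I [U [d [EU Ud dle sum]]]] := has_coverE (cov delta _).
  by rewrite delta_gt0.
(* Null diameters are replaced by small positive ones. *)
pose eta i := Num.min delta ((eps' / (2 ^ i.+1)%:R) `^ s^-1).
have eta0 i : 0 < eta i.
  by rewrite lt_min delta_gt0 powR_gt0// divr_gt0// ltr0n expn_gt0.
pose e i := Num.max (d i) (eta i).
have e0 i : 0 < e i by rewrite lt_max eta0 orbT.
have eta_s i : (eta i) `^ s <= eps' / (2 ^ i.+1)%:R.
  have p0 : 0 <= eps' / (2 ^ i.+1)%:R by rewrite divr_ge0// ltW.
  have root p : 0 <= p -> (p `^ s^-1) `^ s = p.
    by move=> pge0; rewrite -powRrM mulVf ?lt0r_neq0// powRr1.
  rewrite -[leRHS](root _ p0).
  apply: ge0_ler_powR; rewrite ?nnegrE ?powR_ge0 ?(ltW s0) ?(ltW (eta0 i))//.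
  by rewrite /eta ge_min ?lexx ?orbT.
have d0 i : I i -> 0 <= d i.
  by move=> /dle /andP[+ _]; apply: le_trans; exact: lower_scale_ge0.
have sum_e : (\esum_(i in I) (e i `^ s)%:E <= (2 * eps')%:E)%E.
  apply: (@le_trans _ _ (\esum_(i in I)
      ((d i `^ s)%:E + (eps' / (2 ^ i.+1)%:R)%:E))%E).
    apply: le_esum => i Ii; rewrite -EFinD lee_fin /e maxEle.
    case: ifP => _; last by rewrite lerDl divr_ge0// ltW.
    by rewrite (le_trans (eta_s i))// lerDr powR_ge0.
  rewrite esumD; last 2 first.
  - by move=> i _; rewrite lee_fin powR_ge0.
  - by move=> i _; rewrite lee_fin divr_ge0// ltW.
  rewrite mulr_natl mulr2n EFinD leeD//.
  by apply: esum_geometric; exact: ltW.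
have ele i : I i -> lower_scale theta delta <= e i <= delta.
  move=> /dle /andP[d1 d2]; rewrite le_max d1/= ge_max d2/=.
  by rewrite ge_min lexx.
have Ue i : I i -> (diam (U i) <= (e i)%:E)%E.
  by move=> Ii; rewrite Ud// lee_fin le_max lexx.
(* The box covers are taken at scale [e i / 2], which is positive and below [rho] since e i <= delta
   <= rho. *)
have /choice[kV kVP] i : exists kV : nat * (nat -> set 'rV[R]_m), I i ->
    [/\ F `<=` \bigcup_(j in `I_kV.1) kV.2 j,
        forall j, (j < kV.1)%N -> (diam (kV.2 j) <= (e i / 2)%:E)%E
      & kV.1%:R <= (e i / 2) `^ (- t)].
  have [Ii|] := pselect (I i); last by exists (0%N, fun=> set0).
  have [|k [V kV]] := boxF (e i / 2); last by exists (k, V).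
  rewrite divr_gt0//=; have /andP[_ ed] := ele i Ii.
  by have := e0 i; move: ed delta2 => /le_trans/[apply]; lra.
have /choice[w wP] i : exists w, U i !=set0 -> U i w.
  have [[w Uiw]|nU] := pselect (U i !=set0); [by exists w|by exists 0].
pose h i : R := e i / (2 * n%:R).
have h0 i : 0 < h i by rewrite divr_gt0// mulr_gt0.
pose K i := [seq (q, j) | q <- enum (offset n),
                         j <- iota 0 (kV i).1].
pose C i (q : (offset n)) := [set x | grid_label (h i) x =
  fun l => grid_label (h i) (w i) l + (q l)%:Z - (2 * n)%:Z].
pose T := (nat * ((offset n) * nat))%type.
apply: (@has_cover_family _ _ _ _ _ _ _ T [set a : T | I a.1 /\ a.2 \in K a.1]
  (fun a => row_prod (C a.1 a.2.1) ((kV a.1).2 a.2.2)) (fun a => e a.1)).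
- by rewrite addn_gt0 n0.
- move=> _ [x Ex [y Fy <-]]; have [i Ii Uix] := EU x Ex.
  have [q Eq] : exists q, C i q x.
    apply: grid_label_near => //; rewrite (_ : _ * h i = e i).
      by apply: (eucl_dist_le_diam (Ue i Ii)) => //; apply: wP; exists x.
    by rewrite natrM /h mulrC divfK// mulf_neq0// ?pnatr_eq0 gt_eqF.
  have [FV _ _] := kVP i Ii; have [j jk Vy] := FV y Fy.
  exists (i, (q, j)); last by exists x => //; exists y.
  by split => //; apply: allpairs_f; rewrite ?mem_enum// mem_iota.
- move=> [i [q j]] [/= Ii /allpairsP[[q' j'] [_ /=]]].
  rewrite mem_iota/= add0n => jk [_ jj']; rewrite -{}jj' in jk.
  apply: diam_le => [|_ _ [x Cx [y Vy <-]] [x' Cx' [y' Vy' <-]]].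
    exact: ltW.
  have dx : eucl_dist x x' <= e i / 2.
    have <- : n%:R * h i = e i / 2 by rewrite /h; field; rewrite gt_eqF.
    by apply: grid_label_dist => //; rewrite Cx Cx'.
  have dy : eucl_dist y y' <= e i / 2.
    by have [_ /(_ j jk) dV _] := kVP i Ii; exact: eucl_dist_le_diam dV Vy Vy'.
  (* Both factors contribute at most [e i / 2], so the squared distance is at most half of the
     square of [e i]. *)
  rewrite -(@ler_pXn2r _ 2) ?nnegrE ?eucl_dist_ge0//; last exact: ltW.
  rewrite eucl_dist_row_mx.
  have := eucl_dist_ge0 x x'; have := eucl_dist_ge0 y y'; have := e0 i.
  nra.
- by move=> a [Ia _]; exact: ele.
- have -> := @esum_seq_fibers R nat _ I K (fun i => (e i `^ (s + t))%:E).
  + apply: (@le_trans _ _ (\esum_(i in I)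
        ((M * 2 `^ t)%:E * (e i `^ s)%:E)%E)).
      apply: le_esum => i Ii; rewrite -!EFinM lee_fin size_allpairs size_iota.
      rewrite natrM -/M -!mulrA ler_pM2l//.
      have [_ _ kle] := kVP i Ii.
      rewrite powRD; last by apply/implyP => _; rewrite gt_eqF.
      have P0 : 0 < (e i / 2) `^ t by rewrite powR_gt0// divr_gt0.
      have et : e i `^ t = (e i / 2) `^ t * 2 `^ t.
        by rewrite -powRM ?divfK// ltW// divr_gt0.
      (* The bound (e/2)^(-t) on the number of sets cancels against e^t = 2^t (e/2)^t, leaving 2^t
         e^s. *)
      apply: (@le_trans _ _ ((e i / 2) `^ (- t) * (e i `^ s * e i `^ t))).
        by rewrite ler_wpM2r// mulr_ge0 ?powR_ge0.
      rewrite powRN et le_eqVlt; apply/orP; left; apply/eqP; field.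
      by rewrite gt_eqF.
    rewrite esumZl ?mulr_gt0//; last by move=> i; rewrite lee_fin powR_ge0.
    apply: (@le_trans _ _ ((M * 2 `^ t)%:E * (2 * eps')%:E)%E).
      by apply: lee_wpmul2l => //; rewrite lee_fin mulr_ge0// ltW.
    rewrite -EFinM lee_fin /eps' le_eqVlt; apply/orP; left; apply/eqP; field.
    by rewrite !gt_eqF.
  + by move=> i; apply: allpairs_uniq; rewrite ?enum_uniq ?iota_uniq// => -[? ?] [].
  + by move=> i _; rewrite lee_fin powR_ge0.
Qed.

(** * The inequalities between dimensions *)

Lemma lower_dim_prod_ge (R : realType) (n m : nat) (theta : R)
    (E : set 'rV[R]_n) (F : set 'rV[R]_m) :
  (0 < n)%N -> (0 < m)%N -> E !=set0 -> F !=set0 ->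
  (lower_dim theta E + lower_dim theta F <= lower_dim theta (row_prod E F))%E.
Proof.
move=> n_gt0 m_gt0 E0 F0; apply: le_ereal_inf_tmp => _ [u adm <-].
have admE := lower_admissible_prodl n_gt0 F0 adm.
have admF := lower_admissible_prodr m_gt0 E0 adm.
have Eu := lower_dim_le admE; have Fu := lower_dim_le admF.
have E_ge0 := lower_dim_ge0 theta E; have F_ge0 := lower_dim_ge0 theta F.
case EE : (lower_dim theta E) Eu E_ge0 => [a| |]//; rewrite !lee_fin => au a0.
case FE : (lower_dim theta F) Fu F_ge0 => [b| |]//; rewrite !lee_fin => bu b0.
rewrite leNgt; apply/negP => uab.
(* Both [a] and [b] are at most [u < a + b], hence positive. So both can be lowered by some [k > 0],
   staying positive and with sum at least [u]; one of the lowered exponents is then admissible,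
   below the corresponding dimension. *)
pose k := Num.min (Num.min a b) (a + b - u) / 2.
have [ka kb ku] : [/\ 2 * k <= a, 2 * k <= b & 2 * k <= a + b - u].
  rewrite /k mulrC divfK//; split; rewrite !ge_min ?lexx ?orbT//.
have k0 : 0 < k.
  by rewrite divr_gt0// !lt_min -andbA; apply/and3P; split; lra.
have prodE : (0 < n + m)%N by rewrite addn_gt0 n_gt0.
have kab : u <= (a - k) + (b - k) by lra.
have [||/lower_dim_le|/lower_dim_le] := lower_admissible_split n_gt0 m_gt0 _ _
  (lower_admissible_le prodE kab adm).
+ lra.
+ lra.
+ by rewrite EE lee_fin; lra.
+ by rewrite FE lee_fin; lra.
Qed.

Lemma lower_dim_le_upper_dim (R : realType) (n : nat) (theta : R)
    (F : set 'rV[R]_n) : (lower_dim theta F <= upper_dim theta F)%E.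
Proof.
apply: le_ereal_inf_tmp => _ [s adm <-].
exact/lower_dim_le/lower_upper_admissible.
Qed.

Lemma upper_dim_prod_le (R : realType) (n m : nat) (theta : R)
    (E : set 'rV[R]_n) (F : set 'rV[R]_m) :
  (0 < n)%N -> F !=set0 ->
  (upper_dim theta (row_prod E F) <= upper_dim theta E + upper_box_dim F)%E.
Proof.
move=> n_gt0 F0.
have E_ge0 := upper_dim_ge0 theta E; have F_ge0 := upper_box_dim_ge0 F0.
case EE : (upper_dim theta E) E_ge0 => [a| |]// a0; last first.
  by rewrite addye ?leey// gt_eqF// (lt_le_trans _ F_ge0)// ltNy0.
case FE : (upper_box_dim F) F_ge0 => [b| |]// b0; last by rewrite leey.
apply/lee_addgt0Pr => e e0.
have [_ [s adm <-]] : exists2 x, [set s%:E | s in upper_admissible theta E] x &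
    (x < a%:E + (e / 4)%:E)%E.
  by apply: ereal_inf_lt; rewrite -/(upper_dim theta E) EE -EFinD lte_fin; lra.
rewrite -EFinD lte_fin => sa.
have [|rho rho0 boxF] := @upper_box_dim_cover _ _ F (b + e / 4) F0.
  by rewrite FE lte_fin; lra.
(* Adding [e / 4] to [s] makes the exponent for [E] positive; the total stays below a + b + 3e/4. *)
have admP : upper_admissible theta (row_prod E F) ((s + e / 4) + (b + e / 4)).
  have s0 := adm.1; rewrite lee_fin in b0.
  apply: (upper_admissible_prod n_gt0 _ _ rho0 boxF); [by lra|by lra|].
  by apply: upper_admissible_le adm => //; lra.
apply: (@le_trans _ _ ((s + e / 4) + (b + e / 4))%:E).
  by apply: ereal_inf_lbound; exists (s + e / 4 + (b + e / 4)).
by rewrite -!EFinD lee_fin; lra.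
Qed.

Local Open Scope ereal_scope.

Theorem proposition2p5 (R : realType) (n m : nat)
    (n_gt0 : (0 < n)%N) (m_gt0 : (0 < m)%N)
    (E : set 'rV[R]_n) (F : set 'rV[R]_m)
    (E0 : E !=set0) (F0 : F !=set0)
    (bE : bounded_set E) (bF : bounded_set F)
    (theta : R) (theta01 : (0 <= theta <= 1)%R) :
  [/\ lower_dim theta E + lower_dim theta F <= lower_dim theta (row_prod E F),
      lower_dim theta (row_prod E F) <= upper_dim theta (row_prod E F)
    & upper_dim theta (row_prod E F) <= upper_dim theta E + upper_box_dim F].
Proof.
split; first exact: lower_dim_prod_ge.
- exact: lower_dim_le_upper_dim.
- exact: upper_dim_prod_le.
Qed.
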